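(* Let $X=(X_t)_{t\ge0}$ be a real-valued Lévy process such that the distribution of $X_1$ has no atoms, and define the Lévy bridge $\mathring X_t=X_t-tX_1$, $t\in[0,1]$. Then $\mathring A=\int_0^1\mathbf 1\{\mathring X_t>0\}\,dt$ is uniformly distributed on $(0,1)$.
   Context: A Lévy process is a càdlàg process with $X_0=0$ and stationary independent increments. *)

(* Defs.v *)
From HB Require Import structures.
From mathcomp Require Import all_boot all_order all_algebra.
From mathcomp Require Import all_classical all_reals all_analysis.
Set Implicit Arguments. Unset Strict Implicit. Unset Printing Implicit Defensive.
Import Order.TTheory GRing.Theory Num.Theory.
Import numFieldNormedType.Exports.
Local Open Scope classical_set_scope.
Local Open Scope ring_scope.

(* A real-valued stochastic process indexed by time t >= 0 is modelled as
   X : R -> T -> R (values at t < 0 are irrelevant). *)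

(* Mutual independence of the random variables Y 0, ..., Y (n-1):
   product rule for all Borel sets (taking B i = setT recovers subfamilies). *)
Definition mutually_independent_rvs (d : measure_display) (T : measurableType d)
  (R : realType) (P : probability T R) (n : nat) (Y : nat -> T -> R) : Prop :=
  forall B : nat -> set R, (forall i, measurable (B i)) ->
    P (\bigcap_(i < n) (Y i @^-1` B i)) = (\prod_(i < n) P (Y i @^-1` B i))%E.

Definition levy_process (d : measure_display) (T : measurableType d)
  (R : realType) (P : probability T R) (X : R -> T -> R) : Prop :=
  (forall t, 0 <= t -> measurable_fun setT (X t)) /\
      (forall w, X 0 w = 0) /\
      (forall w t, 0 <= t ->
         (fun s => X s w) @ at_right t --> X t w) /\
      (forall w t, 0 < t -> cvg ((fun s => X s w) @ at_left t)) /\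
      (forall s t, 0 <= s -> 0 <= t -> forall B : set R, measurable B ->
         P [set w | X (s + t) w - X s w \in B] = P [set w | X t w \in B]) /\
      (forall (n : nat) (t : nat -> R), 0 <= t 0%N -> (forall i, t i <= t i.+1) ->
         mutually_independent_rvs P n (fun i w => X (t i.+1) w - X (t i) w)).

Definition no_atoms (d : measure_display) (T : measurableType d)
  (R : realType) (P : probability T R) (Y : T -> R) : Prop :=
  forall x : R, P [set w | Y w = x] = 0%E.

Definition levy_bridge (T : Type) (R : realType) (X : R -> T -> R) (t : R) (w : T) : R :=
  X t w - t * X 1 w.

Definition bridge_positive_time (T : Type) (R : realType) (X : R -> T -> R) (w : T) : R :=
  Rintegral lebesgue_measure `[0, 1]
    (fun t => \1_[set s | 0 < levy_bridge X s w] t).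

(* Main.v *)
Require Import Defs.
From HB Require Import structures.
From mathcomp Require Import all_boot all_order all_algebra.
From mathcomp Require Import all_classical all_reals all_analysis.
From mathcomp Require Import ring lra.
From mathcomp Require Import measurable_realfun.
Import Order.TTheory GRing.Theory Num.Theory.
Import numFieldNormedType.Exports.
Local Open Scope classical_set_scope.
Local Open Scope ring_scope.
Set Implicit Arguments. Unset Strict Implicit. Unset Printing Implicit Defensive.

(** The grid values [X_(k/n) - (k/n) X_1], 0 <= k < n, of the bridge form the
    bridge of a random walk with i.i.d. steps. Shifting the steps cyclically by j
    preserves their law and turns the number of positive bridge values into the
    rank of the j-th bridge value. Almost surely there are no ties: a tie is, up
    to a shift, an equation (1 - t) U = t V with U = X_t and V = X_1 - X_t
    independent, one of which is atomless because U + V is. The n ranks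
    are then a permutation of 0, ..., n - 1, so the number of positive grid values
    is uniform on {0, ..., n - 1}. By right-continuity and dominated convergence
    on the product of the probability space and [0, 1], the proportion of
    positive grid values converges in L1 to the occupation time, which therefore
    has the uniform distribution function. *)

(** * Cyclic shifts of discrete bridges *)

Section cyclic_bridge.
Context {R : realFieldType} {n : nat}.
Implicit Types (x : 'I_n.+1 -> R) (j : 'I_n.+1).

Definition mean x : R := (\sum_i x i) / n.+1%:R.

(* The bridge of the walk with steps [x], extended periodically. *)
Definition bridge_sum x (m : nat) : R := \sum_(i < m) (x (inZp i) - mean x).

Definition rotate x j : 'I_n.+1 -> R := fun i => x (i + j).

Definition positive_count x : nat := \sum_(k < n.+1) (0 < bridge_sum x k)%R.

Lemma sum_rotate x j : \sum_i rotate x j i = \sum_i x i.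
Proof. by rewrite [RHS](reindex_inj (addIr j)). Qed.

Lemma mean_rotate x j : mean (rotate x j) = mean x.
Proof. by rewrite /mean sum_rotate. Qed.

Lemma inZpD a b : inZp (a + b) = inZp a + inZp b :> 'I_n.+1.
Proof. by apply: val_inj => /=; rewrite modnDm. Qed.

(** Rotation leaves the mean, hence the centring, unchanged, so the bridge restarted at index [m] is
    the bridge of the rotated steps. *)
Lemma bridge_sumD x m k : bridge_sum x (m + k) =
  bridge_sum x m + bridge_sum (rotate x (inZp m)) k.
Proof.
rewrite /bridge_sum big_split_ord/= mean_rotate; congr (_ + _).
by apply: eq_bigr => i _; rewrite /rotate inZpD (addrC (inZp m)).
Qed.

Lemma bridge_sum_full x : bridge_sum x n.+1 = 0.
Proof.
rewrite /bridge_sum sumrB sumr_const card_ord -mulr_natr /mean divfK ?pnatr_eq0//.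
by apply/eqP; rewrite subr_eq0; apply/eqP/eq_bigr => i _; rewrite valZpK.
Qed.

Lemma bridge_sum_mod x m : bridge_sum x m = bridge_sum x (m %% n.+1).
Proof.
rewrite {1}(divn_eq m n.+1); elim: (m %/ n.+1)%N => [|q <-]; first by rewrite mul0n.
rewrite mulSn -addnA bridge_sumD bridge_sum_full add0r; congr bridge_sum.
apply/funext => i; rewrite /rotate; congr x.
by apply: val_inj; rewrite /= modnn addn0 modn_small.
Qed.

Lemma bridge_sum_rotate x j k :
  bridge_sum (rotate x j) k = bridge_sum x (j + k) - bridge_sum x j.
Proof. by rewrite bridge_sumD addrC addKr valZpK. Qed.

(* Rotating by [j] turns the count into the rank of the [j]-th bridge value. *)
Lemma positive_count_rotate x j : positive_count (rotate x j) =
  (\sum_(k < n.+1) (bridge_sum x j < bridge_sum x k)%R)%N.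
Proof.
rewrite /positive_count [RHS](reindex_inj (addrI j))/=.
apply: eq_bigr => k _.
by rewrite bridge_sum_rotate subr_gt0 (bridge_sum_mod x (j + k)).
Qed.

(** The value at index 0 is 0, hence never counted: at most [n] of the [n.+1] terms contribute. *)
Lemma positive_count_lt x : (positive_count x < n.+1)%N.
Proof.
rewrite /positive_count big_ord_recl {1}/bridge_sum big_ord0 ltxx add0n ltnS.
by rewrite -[leqRHS]card_ord -sum1_card leq_sum// => i _; case: (_ < _).
Qed.

(** The count after rotation is the number of bridge values strictly above the [j]-th one, which
    strictly decreases as that value grows. *)
Lemma positive_count_rotate_inj x :
  injective (fun j => bridge_sum x j) ->
  injective (fun j => positive_count (rotate x j)).
Proof.
move=> x_inj.
suff H j j' : bridge_sum x j < bridge_sum x j' ->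
    (positive_count (rotate x j') < positive_count (rotate x j))%N.
  move=> j j' /= E; apply: x_inj; case: (ltgtP (bridge_sum x j) (bridge_sum x j')) => // /H.
    by rewrite E ltnn.
  by rewrite E ltnn.
(* The index [j'] gives strictness: its value is above that of [j] but not above itself.
   Transitivity handles the other indices. *)
move=> jj'; rewrite !positive_count_rotate (bigD1 j')//= [ltnRHS](bigD1 j')//=.
rewrite ltxx jj' add0n ltnS; apply: leq_sum => k _.
by case: (ltP (bridge_sum x j')) => // /(lt_trans jj') ->.
Qed.

(** The [n.+1] counts are distinct elements of ['I_n.+1], hence a permutation of it, so counting
    those below [m] amounts to counting the indices below [m]. *)
Lemma sum_positive_count_rotate x m :
  injective (fun j => bridge_sum x j) ->
  (\sum_j (positive_count (rotate x j) < m))%N = minn m n.+1.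
Proof.
move=> x_inj; pose f j := Ordinal (positive_count_lt (rotate x j)).
have f_inj : injective f.
  by move=> j j' /(congr1 val)/= /(positive_count_rotate_inj x_inj).
transitivity (\sum_(i < n.+1) (i < m))%N; first by rewrite [RHS](reindex_inj f_inj).
elim: {f f_inj x_inj x} n.+1 => [|k IH]; first by rewrite big_ord0 minn0.
rewrite big_ord_recr/= IH; case: (boolP (k < m)%N) => km; last rewrite -leqNgt in km.
  by rewrite (minn_idPr (ltnW km)) (minn_idPr km) addn1.
by rewrite addn0 (minn_idPl km) (minn_idPl (leqW km)).
Qed.

End cyclic_bridge.

(** * Uniqueness of measures *)

Section measure_uniqueness.
Context {R : realType}.
Local Open Scope ereal_scope.

(** Closed rays are stable under intersection, generate the Borel sets and exhaust the line along
    the integers. *)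
Lemma measure_unique_closed_rays (m1 m2 : probability (measurableTypeR R) R) :
  (forall x, m1 `]-oo, x]%classic = m2 `]-oo, x]%classic) ->
  forall B, measurable B -> m1 B = m2 B.
Proof.
move=> m12 B mB.
pose G := [set A : set R | exists x, A = `]-oo, x]%classic].
apply: (@measure_unique _ R (measurableTypeR R) G
  (fun n => `]-oo, n%:R]%classic) _ _ _ _ m1 m2) => //.
- rewrite eqEsubset; split => A; last first.
    by apply: smallest_sub; [exact: sigma_algebra_measurable|move=> _ [x ->]].
  move=> mA; have : (@ocitv R).-sigma.-measurable A by [].
  (* The open rays []x, +oo[] also generate the Borel sets, and they are the complements of the
     closed rays. *)
  rewrite (RGenOInfty.measurableE R); apply: smallest_sub.
    exact: smallest_sigma_algebra.
  move=> _ [x ->]; rewrite -setCitvl.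
  apply: (@measurableC _ (g_sigma_algebraType G)).
  by apply: sub_sigma_algebra; exists x.
- move=> _ _ [x ->] [y ->]; exists (Num.min x y).
  by apply/seteqP; split => z; rewrite /= !in_itv/= le_min => /andP.
- by move=> i; exists i%:R.
- apply/seteqP; split => // x _; exists (Num.truncn x).+1 => //=.
  by rewrite in_itv/= ltW// truncnS_gt.
- by move=> _ [x ->]; exact: m12.
- by move=> k; rewrite (le_lt_trans (probability_le1 _ _)) ?ltry.
Qed.

Definition tuple_box {n} (B : 'I_n -> set R) : set (n.-tuple R) :=
  [set x | forall i, B i (tnth x i)].

Lemma measurable_tuple_box n (B : 'I_n -> set R) :
  (forall i, measurable (B i)) -> measurable (tuple_box B).
Proof.
move=> mB; rewrite (_ : tuple_box B = \bigcap_(i in [set: 'I_n])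
  ((@tnth n R)^~ i @^-1` B i)).
  apply: fin_bigcap_measurable => // i _.
  by rewrite -[X in measurable X]setTI; exact: measurable_tnth.
by apply/seteqP; split=> x xB i => [_|]; [exact: xB|exact: (xB i I)].
Qed.

(** Boxes form a pi-system containing the whole space. A box with all sides but one equal to [setT]
    is a coordinate cylinder, and cylinders generate the product sigma-algebra. *)
Lemma measure_unique_tuple_box n (m1 m2 : {measure set (n.-tuple R) -> \bar R}) :
  m1 setT < +oo ->
  (forall B : 'I_n -> set R, (forall i, measurable (B i)) ->
    m1 (tuple_box B) = m2 (tuple_box B)) ->
  forall E, measurable E -> m1 E = m2 E.
Proof.
move=> m1oo m12 E mE.
pose G := [set A : set (n.-tuple R) | exists2 B : 'I_n -> set R,
  (forall i, measurable (B i)) & A = tuple_box B].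
have GT : G setT.
  by exists (fun=> setT) => //; apply/seteqP; split=> x.
apply: (@measure_unique _ _ _ G (fun=> setT)) => //.
- rewrite eqEsubset; split => A; last first.
    apply: smallest_sub; first exact: sigma_algebra_measurable.
    by move=> _ [B mB ->]; exact: measurable_tuple_box.
  apply: smallest_sub; first exact: smallest_sigma_algebra.
  apply: (big_ind (fun S => S `<=` <<s G>>)); first exact: sub0set.
    by move=> S S' SG S'G C [/SG|/S'G].
  move=> i _ _ [C mC <-]; apply: sub_sigma_algebra.
  exists (fun k => if k == i then C else setT); first by move=> k; case: ifP.
  apply/seteqP; split=> x; first by move=> [_ xC] k; case: eqP => // ->.
  by move=> /(_ i); rewrite eqxx.
- move=> _ _ [B mB ->] [C mC ->]; exists (fun i => B i `&` C i).
    by move=> i; exact: measurableI.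
  apply/seteqP; split => z; first by move=> [zB zC] i; split.
  by move=> zBC; split=> i; have [] := zBC i.
- by rewrite bigcup_const.
- by move=> _ [B mB ->]; exact: m12.
Qed.

End measure_uniqueness.

(** * Independence *)

Section independence.
Context {d : measure_display} {T : measurableType d} {R : realType}.
Variable P : probability T R.
Local Open Scope ereal_scope.

(** Relabelling by the bijection [s] turns the box into one constraint on each [Y k]; as all laws
    coincide, the product does not depend on [s]. *)
Lemma iid_tuple_box n (Y : nat -> T -> R) (s : 'I_n -> 'I_n) (B : 'I_n -> set R) :
  injective s -> mutually_independent_rvs P n Y ->
  (forall i A, measurable A -> P (Y i @^-1` A) = P (Y 0%N @^-1` A)) ->
  (forall i, measurable (B i)) ->
  P [set w | tuple_box B [tuple Y (s i) w | i < n]] = \prod_(i < n) P (Y 0%N @^-1` B i).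
Proof.
move=> /injF_bij[g sK gK] indep ident mB.
(* Independence is stated for sets indexed by [nat], so the permuted sides are extended by [setT]
   from index [n] on. *)
pose B' k := if insub k is Some k' then B (g k') else setT.
have B'E (k : 'I_n) : B' k = B (g k) by rewrite /B' valK.
have mB' k : measurable (B' k) by rewrite /B'; case: insub.
transitivity (P (\bigcap_(k < n) (Y k @^-1` B' k))).
  congr (P _); apply/seteqP; split=> w wB.
    move=> k /= kn; have := wB (g (Ordinal kn)).
    by rewrite tnth_mktuple gK -[k]/(val (Ordinal kn)) B'E.
  move=> i; rewrite tnth_mktuple; have := wB (s i) (ltn_ord _).
  by rewrite /= B'E sK.
rewrite indep// (reindex s); last by exists g => i _.
by apply: eq_bigr => i _; rewrite B'E sK ident.
Qed.

(** The permuted and the original vector give each box the same mass, and boxes determine the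
    law. *)
Lemma iid_exchangeable n (Y : nat -> T -> R) (s : 'I_n -> 'I_n) :
  injective s -> (forall i, measurable_fun setT (Y i)) ->
  mutually_independent_rvs P n Y ->
  (forall i A, measurable A -> P (Y i @^-1` A) = P (Y 0%N @^-1` A)) ->
  forall E, measurable E ->
    P [set w | E [tuple Y (s i) w | i < n]] = P [set w | E [tuple Y i w | i < n]].
Proof.
move=> s_inj mY indep ident E mE.
have mtuple (r : 'I_n -> 'I_n) : measurable_fun setT (fun w => [tuple Y (r i) w | i < n]).
  apply/measurable_fun_tnthP => i.
  rewrite (_ : _ \o _ = Y (r i)) //.
  by apply/funext => w; rewrite /= tnth_mktuple.
pose f (r : 'I_n -> 'I_n) : {mfun T >-> n.-tuple R} :=
  HB.pack (fun w => [tuple Y (r i) w | i < n])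
    (isMeasurableFun.Build _ _ _ _ _ (mtuple r)).
apply: (measure_unique_tuple_box (m1 := distribution P (f s))
  (m2 := distribution P (f id))) => //.
  by rewrite (le_lt_trans (probability_le1 _ _)) ?ltry.
move=> B mB; rewrite /distribution /pushforward /=.
by rewrite [LHS](iid_tuple_box s_inj)// [RHS](iid_tuple_box (@inj_id _)).
Qed.

Variables U V : T -> R.
Hypotheses (mU : measurable_fun setT U) (mV : measurable_fun setT V).
Hypothesis indepUV : forall A B, measurable A -> measurable B ->
  P (U @^-1` A `&` V @^-1` B) = P (U @^-1` A) * P (V @^-1` B).

(** Under the product law, the section of the line above each [u] is a single point, null for an
    atomless [V]. *)
Lemma independent_graph_null (c : R) : no_atoms P V ->
  P [set w | V w = (c * U w)%R] = 0.
Proof.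
move=> Vna.
pose fU : {mfun T >-> R} := HB.pack U (isMeasurableFun.Build _ _ _ _ _ mU).
pose fV : {mfun T >-> R} := HB.pack V (isMeasurableFun.Build _ _ _ _ _ mV).
have mUV : measurable_fun setT (fun w => (U w, V w)) by exact: measurable_fun_pair.
pose fUV : {mfun T >-> (R * R)%type} :=
  HB.pack (fun w => (U w, V w)) (isMeasurableFun.Build _ _ _ _ _ mUV).
pose X := [set z : R * R | z.2 = (c * z.1)%R].
have mX : measurable X.
  rewrite (_ : X = (fun z : R * R => (z.2 - c * z.1)%R) @^-1` [set 0%R]).
    rewrite -[X in measurable X]setTI; apply: measurable_funB => //.
    exact: measurable_funM.
  by apply/seteqP; split=> z /=; [move=> ->; rewrite subrr|move/eqP; rewrite subr_eq0 => /eqP].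
rewrite -[LHS]/(distribution P fUV X).
(* Independence identifies the joint law with the product of the marginals. *)
rewrite -(@product_measure_unique _ _ _ _ _ (distribution P fU) (distribution P fV))//.
rewrite /product_measure1 integral0_eq// => u _.
rewrite /= (_ : xsection X u = [set (c * u)%R]); first exact: Vna.
by apply/seteqP; split=> v; rewrite /xsection /= ?inE.
Qed.

End independence.

(** One of [U] and [V] is atomless: by independence, atoms [u] and [v] of both would give [U + V] an
    atom at [u + v]. The equation is then solved for the atomless variable. *)
Lemma independent_lincomb_null (d : measure_display) (T : measurableType d) (R : realType)
    (P : probability T R) (U V : T -> R) (a b : R) :
  measurable_fun setT U -> measurable_fun setT V ->
  (forall A B, measurable A -> measurable B ->
    P (U @^-1` A `&` V @^-1` B) = P (U @^-1` A) * P (V @^-1` B))%E ->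
  no_atoms P (fun w => U w + V w) -> a != 0 -> b != 0 ->
  P [set w | a * U w = b * V w] = 0%E.
Proof.
move=> mU mV indep UVna a0 b0.
have [Una|Ua] := pselect (no_atoms P U).
  rewrite (_ : [set _ | _] = [set w | U w = (a^-1 * b) * V w]).
    apply: independent_graph_null => // A B mA mB.
    by rewrite setIC indep// muleC.
  apply/seteqP; split=> w /=; first by move=> /(congr1 ( *%R a^-1)); rewrite mulKf// mulrA.
  by move=> ->; rewrite -mulrA mulVKf.
have Vna : no_atoms P V.
  move=> v; apply: contra_notP Ua => Pv u; apply/eqP.
  have : P (U @^-1` [set u] `&` V @^-1` [set v]) == 0%E.
    rewrite eq_le measure_ge0 andbT -(UVna (u + v)) le_measure ?inE//.
    - by apply: measurableI; rewrite -[X in measurable X]setTI; [exact: mU|exact: mV].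
    - rewrite -[X in measurable X]setTI.
      exact: (measurable_funD mU mV measurableT (measurable_set1 (u + v))).
    - by move=> w /= [-> ->].
  rewrite indep// mule_eq0 => /orP[//|/eqP]; by move/Pv.
rewrite (_ : [set _ | _] = [set w | V w = (b^-1 * a) * U w]).
  exact: independent_graph_null.
apply/seteqP; split=> w /=; first by move=> /(congr1 ( *%R b^-1)); rewrite mulKf// mulrA => ->.
by move=> ->; rewrite -mulrA mulVKf.
Qed.

(** * The bridge on a grid *)

Lemma measurable_bridge_sum (R : realType) n m :
  measurable_fun setT (fun x : n.+1.-tuple R => bridge_sum (tnth x) m).
Proof.
rewrite /bridge_sum; apply: measurable_sum => i; apply: measurable_funB.
  exact: measurable_tnth.
rewrite /mean; apply: measurable_funM => //.
by apply: measurable_sum => j; exact: measurable_tnth.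
Qed.

Lemma measurable_positive_count (R : realType) n m :
  measurable [set x : n.+1.-tuple R | (positive_count (tnth x) < m)%N].
Proof.
pose pos (k : 'I_n.+1) := [set x : n.+1.-tuple R | 0 < bridge_sum (tnth x) k].
pose f (x : n.+1.-tuple R) : R := \sum_(k < n.+1) \1_(pos k) x.
have mf : measurable_fun setT f.
  apply: measurable_sum => k; apply: measurable_indic.
  rewrite (_ : pos k = (fun x => bridge_sum (tnth x) k) @^-1` `]0, +oo[%classic).
    by rewrite -[X in measurable X]setTI; exact: measurable_bridge_sum.
  by apply/seteqP; split=> x; rewrite /pos /= in_itv/= andbT.
have fE x : f x = (positive_count (tnth x))%:R.
  rewrite /positive_count natr_sum; apply: eq_bigr => k _.
  by rewrite indicE; congr (nat_of_bool _)%:R; apply/idP/idP; rewrite inE.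
rewrite (_ : [set _ | _] = f @^-1` `]-oo, m%:R[%classic).
  by rewrite -[X in measurable X]setTI; exact: mf.
by apply/seteqP; split=> x; rewrite /= in_itv/= fE ltr_nat.
Qed.

Section levy.
Context {d : measure_display} {T : measurableType d} {R : realType}.
Variables (P : probability T R) (X : R -> T -> R).
Hypotheses (levyX : levy_process P X) (X1na : no_atoms P (X 1)).

Lemma levy_bridge0 w : levy_bridge X 0 w = 0.
Proof. by case: levyX => _ [X0 _]; rewrite /levy_bridge X0 mul0r subr0. Qed.

Lemma levy_bridge1 w : levy_bridge X 1 w = 0.
Proof. by rewrite /levy_bridge mul1r subrr. Qed.

Lemma measurable_levy_bridge t : 0 <= t -> measurable_fun setT (levy_bridge X t).
Proof.
case: levyX => mX _ t0; apply: measurable_funB; first exact: mX.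
by apply: measurable_funM => //; exact: mX.
Qed.

(** The equation reads [(1 - t) * X t = t * (X 1 - X t)], a relation between independent increments
    with atomless sum [X 1]. *)
Lemma levy_bridge_zero_null t : 0 < t < 1 -> P [set w | levy_bridge X t w = 0] = 0%E.
Proof.
case: levyX => mX [X0 [_ [_ [_ indep]]]] /andP[t0 t1].
(* The subdivision 0, [t], 1, continued by 1 so that it is nondecreasing at all indices. *)
pose s i : R := if i is i'.+1 then if i' is _.+1 then 1 else t else 0.
rewrite (_ : [set _ | _] = [set w | (1 - t) * X t w = t * (X 1 w - X t w)]).
  apply: independent_lincomb_null.
  - exact/mX/ltW.
  - by apply: measurable_funB; apply: mX => //; exact: ltW.
  - move=> A B mA mB.
    have sS i : s i <= s i.+1 by case: i => [|[|i]] /=; rewrite ?(ltW t0) ?(ltW t1).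
    have := indep 2%N s (lexx _) sS (fun i => if i is 0%N then A else B).
    rewrite big_ord_recl big_ord1 bigcap_mkord big_ord_recl big_ord1/=.
    have -> : (fun w => X t w - X 0 w) = X t by apply/funext => w; rewrite X0 subr0.
    by apply; case.
  - by move=> x; under eq_set do rewrite addrC subrK; exact: X1na.
  - by rewrite subr_eq0 gt_eqF.
  - by rewrite gt_eqF.
rewrite /levy_bridge; apply/seteqP; split=> w /= E; lra.
Qed.

(** * Grid increments, their rotation invariance and the law of the positive count *)

Definition grid_increment n (i : nat) (w : T) : R :=
  X (i.+1%:R / n.+1%:R) w - X (i%:R / n.+1%:R) w.

Lemma measurable_grid_increment n i : measurable_fun setT (grid_increment n i).
Proof. by case: levyX => mX _; apply: measurable_funB; apply: mX; rewrite divr_ge0. Qed.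

(** The increments telescope and their mean is [X 1 w / n.+1%:R], so centring subtracts exactly the
    linear part. The bound on [k] stays within one period of [bridge_sum]. *)
Lemma bridge_sum_grid_increment n (k : nat) w : (k <= n.+1)%N ->
  bridge_sum (fun i : 'I_n.+1 => grid_increment n i w) k = levy_bridge X (k%:R / n.+1%:R) w.
Proof.
case: levyX => _ [X0 _].
have tele m : (m <= n.+1)%N ->
    \sum_(i < m) grid_increment n (inZp i : 'I_n.+1) w = X (m%:R / n.+1%:R) w.
  elim: m => [|m IH] mn; first by rewrite big_ord0 mul0r X0.
  by rewrite big_ord_recr/= IH ?(ltnW mn)// /grid_increment modn_small// addrC subrK.
move=> kn; rewrite /bridge_sum sumrB tele// sumr_const card_ord /levy_bridge.
congr (_ - _); rewrite /mean -mulr_natl.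
rewrite (eq_bigr (fun i : 'I_n.+1 => grid_increment n (inZp i : 'I_n.+1) w)); last first.
  by move=> i _; rewrite valZpK.
rewrite tele// divff ?pnatr_eq0//; ring.
Qed.

Definition grid_steps n (w : T) : 'I_n.+1 -> R := fun i => grid_increment n i w.
Arguments grid_steps n w : clear implicits.

Lemma grid_steps_tuple n w :
  grid_steps n w = tnth [tuple grid_increment n i w | i < n.+1].
Proof. by apply/funext => i; rewrite tnth_mktuple. Qed.

Lemma grid_steps_measurable n (Q : set ('I_n.+1 -> R)) :
  measurable [set x : n.+1.-tuple R | Q (tnth x)] ->
  measurable [set w | Q (grid_steps n w)].
Proof.
move=> mQ; rewrite (_ : [set w | _] =
    (fun w => [tuple grid_increment n i w | i < n.+1]) @^-1` [set x | Q (tnth x)]).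
  rewrite -[X in measurable X]setTI.
  suff : measurable_fun setT (fun w => [tuple grid_increment n i w | i < n.+1]) by exact.
  apply/measurable_fun_tnthP => i.
  rewrite (_ : _ \o _ = grid_increment n i); first exact: measurable_grid_increment.
  by apply/funext => w; rewrite /= tnth_mktuple.
by apply/seteqP; split=> w; rewrite /= grid_steps_tuple.
Qed.

Lemma measurable_count_lt n m :
  measurable [set w | (positive_count (grid_steps n w) < m)%N].
Proof.
apply: (grid_steps_measurable (Q := [set y | (positive_count y < m)%N])).
exact: measurable_positive_count.
Qed.

(** Increments over cells of equal length are i.i.d., hence exchangeable, and a rotation permutes
    the indices. *)
Lemma rotate_grid_steps_law n (j : 'I_n.+1) (Q : set ('I_n.+1 -> R)) :
  measurable [set x : n.+1.-tuple R | Q (tnth x)] ->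
  P [set w | Q (rotate (grid_steps n w) j)] = P [set w | Q (grid_steps n w)].
Proof.
case: levyX => mX [_ [_ [_ [stat indep]]]] mQ.
have ident i A : measurable A ->
    P (grid_increment n i @^-1` A) = P (grid_increment n 0 @^-1` A).
  have unit_law k : measurable A ->
      P (grid_increment n k @^-1` A) = P [set w | X (1 / n.+1%:R) w \in A].
    move=> mA; rewrite -(stat (k%:R / n.+1%:R)) ?divr_ge0//.
    congr (P _); apply/seteqP; split=> w;
      by rewrite /= /grid_increment -mulrDl natr1 inE.
  by move=> mA; rewrite !unit_law.
have ge0 : 0 <= 0%:R / n.+1%:R :> R by rewrite mul0r.
have nd i : i%:R / n.+1%:R <= i.+1%:R / n.+1%:R :> R.
  by rewrite ler_pM2r ?invr_gt0 ?ltr0n// ler_nat.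
have := iid_exchangeable (addIr j) (@measurable_grid_increment n)
  (indep n.+1 (fun i => i%:R / n.+1%:R) ge0 nd) ident mQ.
rewrite /=; set A := P _ => EA; set B := P _.
transitivity A; rewrite /A/B.
  congr (P _); apply/seteqP; split=> w /=; rewrite (_ : tnth _ = rotate (grid_steps n w) j)//;
  by apply/funext => i; rewrite tnth_mktuple.
rewrite -/A EA; congr (P _).
by apply/seteqP; split=> w /=; rewrite -grid_steps_tuple.
Qed.

(** Rotating by the smaller index turns the tie into a zero of the bridge at a grid time strictly
    between 0 and 1. *)
Lemma bridge_sum_grid_tie n (j k : 'I_n.+1) : j != k ->
  P [set w | bridge_sum (grid_steps n w) j = bridge_sum (grid_steps n w) k] = 0%E.
Proof.
wlog jk : j k / (j < k)%N.
  move=> H; rewrite neq_ltn => /orP[jk|kj]; first by apply: H; rewrite // neq_ltn jk.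
  rewrite -(H k j kj) ?neq_ltn ?kj//.
  by congr (P _); apply/seteqP; split=> w /=.
move=> _.
have kj_gt0 : (0 < k - j)%N by rewrite subn_gt0.
have kj_lt : (k - j < n.+1)%N by rewrite (leq_ltn_trans (leq_subr _ _)).
rewrite (_ : [set _ | _] =
  [set w | bridge_sum (rotate (grid_steps n w) j) (k - j) = 0]).
  rewrite (rotate_grid_steps_law j (Q := [set x | bridge_sum x (k - j) = 0])).
    rewrite -(@levy_bridge_zero_null ((k - j)%:R / n.+1%:R)).
      congr (P _); apply/seteqP; split=> w /=.
        by rewrite bridge_sum_grid_increment// ltnW.
      by move=> <-; rewrite bridge_sum_grid_increment// ltnW.
    by rewrite divr_gt0 ?ltr0n//= ltr_pdivrMr ?ltr0n// mul1r ltr_nat.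
  rewrite -[X in measurable X]setTI.
  exact: (@measurable_bridge_sum R n (k - j) measurableT _ (measurable_set1 0)).
apply/seteqP; split=> w /=; rewrite bridge_sum_rotate subnKC ?(ltnW jk)//.
  by move=> ->; rewrite subrr.
by move=> /eqP; rewrite subr_eq0 => /eqP.
Qed.

(** All rotations have the same law, so [n.+1] times the probability is the expected number of
    rotations with count below [m]. Without ties this number is the constant [minn m n.+1]. *)
Lemma positive_count_law n m :
  P [set w | (positive_count (grid_steps n w) < m)%N] =
    ((minn m n.+1)%:R / n.+1%:R)%:E.
Proof.
pose E (j : 'I_n.+1) := [set w | (positive_count (rotate (grid_steps n w) j) < m)%N].
pose E0 := [set w | (positive_count (grid_steps n w) < m)%N].
have mE j : measurable (E j).
  apply: (grid_steps_measurable (Q := [set x | (positive_count (rotate x j) < m)%N])).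
  rewrite (_ : [set _ | _] = (fun t : n.+1.-tuple R => [tuple tnth t (i + j) | i < n.+1]) @^-1`
      [set t | (positive_count (tnth t) < m)%N]).
    rewrite -[X in measurable X]setTI.
    suff mrot : measurable_fun setT
        (fun t : n.+1.-tuple R => [tuple tnth t (i + j) | i < n.+1]).
      by apply: mrot => //; exact: measurable_positive_count.
    apply/measurable_fun_tnthP => i.
    rewrite (_ : _ \o _ = (fun t => tnth t (i + j))); first exact: measurable_tnth.
    by apply/funext => t; rewrite /= tnth_mktuple.
  apply/seteqP; split=> t /=;
    rewrite (_ : tnth [tuple tnth t (i + j) | i < n.+1] = rotate (tnth t) j)//;
    by apply/funext => i; rewrite tnth_mktuple.
have PE j : P (E j) = P E0.
  apply: (rotate_grid_steps_law j (Q := [set x | (positive_count x < m)%N])).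
  exact: measurable_positive_count.
have : (\sum_(j < n.+1) P (E j) = (minn m n.+1)%:R%:E)%E.
  transitivity (\sum_(j < n.+1) \int[P]_w (\1_(E j) w)%:E)%E.
    by apply: eq_bigr => j _; rewrite integral_indic// setIT.
  rewrite -ge0_integral_sum//; last first.
    by move=> j; apply/measurable_EFinP; exact: measurable_indic.
  transitivity (\int[P]_w (minn m n.+1)%:R%:E)%E; last first.
    by rewrite integral_cst// [X in (_ * X)%E]probability_setT mule1.
  apply: ge0_ae_eq_integral => //.
  - apply: emeasurable_sum => j; apply/measurable_EFinP; exact: measurable_indic.
  - by move=> w _; apply: sume_ge0 => j _; rewrite lee_fin.
  (* There are finitely many pairs of indices, so the null events of a tie can be discarded
     together. *)
  have noties : \forall w \ae P, forall j k : 'I_n.+1, j != k ->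
      bridge_sum (grid_steps n w) j <> bridge_sum (grid_steps n w) k.
    apply: filter_forall => j; apply: filter_forall => k.
    have [->|jk] := eqVneq j k; first exact: aeW.
    exists [set w | bridge_sum (grid_steps n w) j = bridge_sum (grid_steps n w) k]; split.
    - apply: (grid_steps_measurable (Q := [set x | bridge_sum x j = bridge_sum x k])).
      have mB i := @measurable_bridge_sum R n i.
      rewrite (_ : [set x | _] = (fun x : n.+1.-tuple R =>
          bridge_sum (tnth x) j - bridge_sum (tnth x) k) @^-1` [set 0]).
        rewrite -[X in measurable X]setTI.
        exact: (measurable_funB (mB j) (mB k) measurableT (measurable_set1 0)).
      apply/seteqP; split=> x /=; first by move=> ->; rewrite subrr.
      by move/eqP; rewrite subr_eq0 => /eqP.
    - exact: bridge_sum_grid_tie.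
    - by move=> w /= /not_implyP[_ /contrapT].
  apply: filterS noties => w noties _ /=.
  rewrite sumEFin -(@sum_positive_count_rotate _ _ (grid_steps n w)); last first.
    by move=> j k /= jk; apply/eqP; apply: contraT => /noties.
  congr (_%:E); rewrite natr_sum; apply: eq_bigr => j _.
  by rewrite indicE; congr (nat_of_bool _)%:R; apply/idP/idP; rewrite inE.
rewrite (eq_bigr (fun=> P E0)); last by move=> j _; exact: PE.
have PE0fin : P E0 \is a fin_num by rewrite fin_num_measure//; exact: measurable_count_lt.
rewrite -/E0 -(fineK PE0fin) sumEFin sumr_const card_ord => -[<-].
by rewrite -[X in X / _]mulr_natr mulfK// pnatr_eq0.
Qed.

End levy.
Arguments grid_steps {d T R} X n w.

(** * Right-endpoint step functions *)

Section step_approximation.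
Context {R : realType}.
Implicit Types (f : R -> R) (n : nat) (t : R).

Definition grid_itv n (k : nat) : set R :=
  `[k%:R / n.+1%:R, k.+1%:R / n.+1%:R[%classic.

(** Sampling at the right endpoint of each cell lets right-continuity of the paths govern the
    limit. *)
Definition step_fun f n t : R :=
  \sum_(k < n.+1) f (k.+1%:R / n.+1%:R) * \1_(grid_itv n k) t.

Lemma grid_itvP n k t : 0 <= t -> grid_itv n k t <-> Num.truncn (n.+1%:R * t) = k.
Proof.
move=> t0; rewrite /grid_itv /= in_itv/= ler_pdivrMr ?ltr0n// ltr_pdivlMr ?ltr0n// mulrC.
rewrite -truncn_eq ?mulr_ge0//; split=> [/eqP//|->//].
Qed.

Lemma step_funE f n t : 0 <= t < 1 ->
  step_fun f n t = f ((Num.truncn (n.+1%:R * t)).+1%:R / n.+1%:R).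
Proof.
move=> /andP[t0 t1].
have kn : (Num.truncn (n.+1%:R * t) < n.+1)%N.
  by rewrite -(ltr_nat R) (@le_lt_trans _ _ (n.+1%:R * t)) ?truncn_le ?mulr_ge0// gtr_pMr.
rewrite /step_fun (bigD1 (Ordinal kn))//= indicE mem_set ?mulr1; last exact/grid_itvP.
rewrite big1 ?addr0// => k kE; rewrite indicE memNset ?mulr0// => /(grid_itvP _ _ t0) tk.
by move/eqP : kE; apply; exact/val_inj.
Qed.

Lemma step_fun_out f n t : ~~ (0 <= t < 1) -> step_fun f n t = 0.
Proof.
move=> t01; apply: big1 => k _; rewrite indicE memNset ?mulr0//.
rewrite /grid_itv /= in_itv/= => /andP[kt tk]; move/negP: t01; apply.
rewrite (le_trans _ kt) ?divr_ge0//= (lt_le_trans tk)//.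
by rewrite ler_pdivrMr ?ltr0n// mul1r ler_nat.
Qed.

(** The right endpoint of the cell of [t] exceeds [t] strictly, by at most [n.+1%:R^-1], so it tends
    to [t] from the right. *)
Lemma cvg_step_fun f t : 0 <= t < 1 -> f @ at_right t --> f t ->
  step_fun f n t @[n --> \oo] --> f t.
Proof.
move=> t01 /cvg_at_rightP ft; have /andP[t0 t1] := t01.
under eq_fun do rewrite step_funE//.
apply: ft; split=> [n|].
  by rewrite ltr_pdivlMr ?ltr0n// mulrC truncnS_gt.
apply: (@squeeze_cvgr _ _ _ _ (cst t) (fun n => t + n.+1%:R^-1)).
- near=> n; rewrite ler_pdivlMr ?ltr0n// mulrC (ltW (truncnS_gt _))//=.
  rewrite ler_pdivrMr ?ltr0n// mulrDl mulVf ?pnatr_eq0// -natr1 lerD2r mulrC.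
  by rewrite truncn_le// mulr_ge0.
- exact: cvg_cst.
- by rewrite -[X in _ --> X]addr0; apply: cvgD; [exact: cvg_cst|exact: cvg_harmonic].
Unshelve. all: by end_near. Qed.

Lemma measurable_grid_itv n k : measurable (grid_itv n k).
Proof. exact: measurable_itv. Qed.

Lemma lebesgue_grid_itv n k : (lebesgue_measure (grid_itv n k) = (n.+1%:R^-1)%:E)%E.
Proof.
rewrite lebesgue_measure_itv/= lte_fin ltr_pM2r ?invr_gt0 ?ltr0n// ltr_nat ltnSn.
by rewrite -EFinB -mulrBl -natrB// subSnn mul1r.
Qed.

Lemma integral_step_fun f n : (forall x, 0 <= f x) ->
  (\int[lebesgue_measure]_t (step_fun f n t)%:E =
    ((\sum_(k < n.+1) f (k.+1%:R / n.+1%:R)) / n.+1%:R)%:E)%E.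
Proof.
move=> f0; under eq_integral do rewrite /step_fun -sumEFin.
rewrite ge0_integral_sum//; last 2 first.
- move=> k; apply/measurable_EFinP; apply: measurable_funM => //.
  by apply: measurable_indic; exact: measurable_grid_itv.
- by move=> k t _; rewrite lee_fin mulr_ge0.
rewrite mulr_suml -sumEFin; apply: eq_bigr => k _.
under eq_integral do rewrite EFinM.
rewrite ge0_integralZl//; last 2 first.
- by apply/measurable_EFinP; apply: measurable_indic; exact: measurable_grid_itv.
- by rewrite lee_fin.
rewrite integral_indic//; last exact: measurable_grid_itv.
by rewrite setIT [X in (_ * X)%E]lebesgue_grid_itv -EFinM.
Qed.

End step_approximation.

(** * Convergence to the occupation time *)

Lemma measurable_pos_indicator (d : measure_display) (T : measurableType d) (R : realType)
  (f : T -> R) : measurable_fun setT f ->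
  measurable_fun setT (fun w => (0 < f w)%R%:R : R).
Proof.
move=> mf; rewrite (_ : (fun w => _) = \1_(f @^-1` `]0, +oo[%classic)).
  by apply: measurable_indic; rewrite -[X in measurable X]setTI; exact: mf.
apply/funext => w; rewrite indicE; congr (nat_of_bool _)%:R.
by apply/idP/idP; rewrite inE /= in_itv/= andbT.
Qed.

Section occupation_time.
Context {d : measure_display} {T : measurableType d} {R : realType}.
Variables (P : probability T R) (X : R -> T -> R).
Hypotheses (levyX : levy_process P X) (X1na : no_atoms P (X 1)).

(* Setting the bridge to 0 off [0, 1[ loses nothing, since it vanishes at time 1. *)
Definition cut_bridge (z : T * measurableTypeR R) : R :=
  if 0 <= z.2 < 1 then levy_bridge X z.2 z.1 else 0.

Definition step_bridge n (z : T * measurableTypeR R) : R :=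
  step_fun (fun t => levy_bridge X t z.1) n z.2.

Definition pos_indic (z : T * measurableTypeR R) : R := (0 < cut_bridge z)%R%:R.

Definition step_pos_indic n (z : T * measurableTypeR R) : R :=
  step_fun (fun t => (0 < levy_bridge X t z.1)%R%:R) n z.2.

Lemma levy_bridge_right_cvg t w : 0 <= t ->
  (fun s => levy_bridge X s w) @ at_right t --> levy_bridge X t w.
Proof.
case: levyX => _ [_ [rc _]] t0; apply: cvgB; first exact: rc.
by apply: cvgM; [exact: cvg_within|exact: cvg_cst].
Qed.

Lemma measurable_step_fun_time (f : R -> T -> R) n :
  (forall t, 0 <= t -> measurable_fun setT (f t)) ->
  measurable_fun setT (fun z : T * measurableTypeR R => step_fun (f ^~ z.1) n z.2).
Proof.
move=> mf; apply: measurable_sum => k; apply: measurable_funM.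
  apply: (measurableT_comp (f := f _)) => //; apply: mf; exact: divr_ge0.
have mI : measurable_fun setT (\1_(grid_itv n k) : measurableTypeR R -> R).
  by apply: measurable_indic; exact: measurable_grid_itv.
exact: (measurableT_comp mI measurable_snd).
Qed.

(** Joint measurability in sample point and time: right-continuity gives a pointwise limit of step
    functions, each a finite sum of products of a function of [w] and a function of [t]. *)
Lemma measurable_cut_bridge : measurable_fun setT cut_bridge.
Proof.
apply: (@measurable_fun_cvg _ _ _ _ step_bridge).
  move=> n; apply: (@measurable_step_fun_time (levy_bridge X)) => t t0.
  exact: (measurable_levy_bridge levyX t0).
move=> [w t] _; rewrite /step_bridge/cut_bridge/=; case: ifPn => t01.
  apply: cvg_step_fun => //; apply: levy_bridge_right_cvg; by case/andP: t01.
under eq_fun do rewrite step_fun_out//.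
exact: cvg_cst.
Qed.

Lemma measurable_pos_indic : measurable_fun setT pos_indic.
Proof. by apply: measurable_pos_indicator; exact: measurable_cut_bridge. Qed.

Lemma measurable_step_pos_indic n : measurable_fun setT (step_pos_indic n).
Proof.
apply: (@measurable_step_fun_time (fun t w => (0 < levy_bridge X t w)%R%:R)) => t t0.
by apply: measurable_pos_indicator; exact: (measurable_levy_bridge levyX t0).
Qed.

(** Where the bridge is nonzero, right-continuity preserves its sign just after [t], so the
    positivity indicator is right-continuous there. *)
Lemma cvg_step_pos_indic z : ~ (0 <= z.2 < 1 /\ cut_bridge z = 0) ->
  step_pos_indic n z @[n --> \oo] --> pos_indic z.
Proof.
case: z => w t; rewrite /step_pos_indic /pos_indic /cut_bridge/=.
case: ifPn => [t01 b0|t01 _]; last first.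
  under eq_fun do rewrite step_fun_out//.
  by rewrite ltxx; exact: cvg_cst.
apply: (cvg_step_fun (f := fun t => (0 < levy_bridge X t w)%R%:R)) => //.
have t0 : 0 <= t by case/andP: t01.
have rc := levy_bridge_right_cvg (w := w) t0.
have {b0} : levy_bridge X t w != 0 by apply/eqP => E; apply: b0.
rewrite neq_lt => /orP[b0|b0].
  apply: cvg_near_cst; rewrite (lt_gtF b0).
  by apply: filterS (cvgr_lt _ rc _ b0) => s sb; rewrite (lt_gtF sb).
apply: cvg_near_cst; rewrite b0.
by apply: filterS (cvgr_gt _ rc _ b0) => s ->.
Qed.

(** At each fixed time in []0, 1[] the bridge is almost surely nonzero; integrating these null
    sections over time gives a null set. *)
Lemma cut_bridge_neq0_ae : \forall z \ae (P \x lebesgue_measure)%E,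
  ~ (0 <= z.2 < 1 /\ cut_bridge z = 0).
Proof.
pose Z := [set z : T * measurableTypeR R | 0 <= z.2 < 1 /\ cut_bridge z = 0].
have mZ : measurable Z.
  rewrite (_ : Z = (setT `*` `[0, 1[%classic) `&` cut_bridge @^-1` [set 0]).
    apply: measurableI; first by apply: measurableX => //; exact: measurable_itv.
    by rewrite -[X in measurable X]setTI; exact: measurable_cut_bridge.
  apply/seteqP; split=> -[w t]; rewrite /Z /= in_itv/=; first by move=> [t01 b0].
  by move=> [[_ t01] b0].
exists Z; split=> //; last by move=> z /contrapT.
(* Uniqueness of the product measure allows slicing at fixed time instead of at a fixed sample
   point. *)
rewrite (@product_measure_unique _ _ _ _ _ P lebesgue_measure
  (P \x^ lebesgue_measure)%E)//; last first.
  by move=> A B mA mB; rewrite /= product_measure2E.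
rewrite /product_measure2.
rewrite -[RHS](integral0 lebesgue_measure setT).
apply: ge0_ae_eq_integral => //; first exact: measurable_fun_ysection.
(* Time 0 is excepted because the bridge starts at 0 at every sample point. *)
exists [set 0]; split; [exact: measurable_set1|exact: lebesgue_measure_set1|].
move=> t /= /not_implyP[_]; apply: contra_notP => /= t0.
have [/andP[t_ge0 t1]|t01] := boolP (0 <= t < 1).
  rewrite (_ : ysection Z t = [set w | levy_bridge X t w = 0]).
    apply: (levy_bridge_zero_null levyX X1na).
    by rewrite t1 andbT lt_neqAle t_ge0 andbT eq_sym; apply/eqP.
  by apply/seteqP; split=> w; rewrite /ysection /= inE /Z /cut_bridge/= t_ge0 t1 => // -[].
rewrite (_ : ysection Z t = set0) ?measure0//.
by apply/seteqP; split=> w //; rewrite /ysection /= inE /Z /= (negbTE t01) => -[].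
Qed.

Lemma pos_indic_ge0 z : 0 <= pos_indic z. Proof. exact: ler0n. Qed.

Lemma pos_indic_le z : pos_indic z <= \1_(`[0, 1]%classic : set R) z.2.
Proof.
rewrite /pos_indic /cut_bridge; case: ifPn => [/andP[z0 z1]|_]; last by rewrite ltxx.
by rewrite indicE mem_set ?lern1 ?leq_b1//= in_itv/= z0 ltW.
Qed.

Lemma step_pos_indic_ge0 n z : 0 <= step_pos_indic n z.
Proof. by apply: sumr_ge0 => k _; rewrite mulr_ge0. Qed.

Lemma step_pos_indic_le n z : step_pos_indic n z <= \1_(`[0, 1]%classic : set R) z.2.
Proof.
rewrite /step_pos_indic; have [z01|z01] := boolP (0 <= z.2 < 1); last first.
  by rewrite step_fun_out.
rewrite step_funE// indicE mem_set ?lern1 ?leq_b1//= in_itv/=.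
by case/andP: z01 => -> /ltW.
Qed.

Lemma integrable_pos_section (f : T * measurableTypeR R -> R) w : measurable_fun setT f ->
  (forall z, 0 <= f z) -> (forall z, f z <= \1_(`[0, 1]%classic : set R) z.2) ->
  lebesgue_measure.-integrable setT (fun t => (f (w, t))%:E).
Proof.
move=> mf f0 f1; apply: le_integrable (integrable_indic_itv 0 1 true false) => //.
  apply/measurable_EFinP; exact: measurable_fun_pair2.
by move=> t _; rewrite /= lee_fin !ger0_norm.
Qed.

Lemma bridge_positive_timeE w :
  ((bridge_positive_time X w)%:E = \int[lebesgue_measure]_t (pos_indic (w, t))%:E)%E.
Proof.
rewrite /bridge_positive_time /Rintegral integral_mkcond.
rewrite (eq_integral (fun t => (pos_indic (w, t))%:E)); last first.
  move=> t _; rewrite patchE /pos_indic /cut_bridge/= mem_setE in_itv/=.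
  (* At time 1 both integrands are 0: the cut bridge by its default value, the bridge itself because
     it ends at 0. *)
  have [->|t1] := eqVneq t 1.
    by rewrite ltxx andbF ler01 lexx/= ltxx indicE memNset//= levy_bridge1 ltxx.
  rewrite (lt_neqAle t) t1/=; case: ifP => [_|]; last by rewrite ltxx.
  by congr (_%:E); rewrite indicE; congr (nat_of_bool _)%:R; apply/idP/idP; rewrite inE.
rewrite fineK//; apply: integrable_fin_num => //.
exact: integrable_pos_section measurable_pos_indic pos_indic_ge0 pos_indic_le.
Qed.

Lemma measurable_bridge_positive_time : measurable_fun setT (bridge_positive_time X).
Proof.
apply/measurable_EFinP.
rewrite (_ : _ \o _ = fubini_F lebesgue_measure (EFin \o pos_indic)).
  apply: measurable_fun_fubini_tonelli_F; last by move=> z; rewrite lee_fin pos_indic_ge0.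
  by apply/measurable_EFinP; exact: measurable_pos_indic.
by apply/funext => w; rewrite /= bridge_positive_timeE.
Qed.

(** The step function samples the indices 1 to [n.+1], the count runs over 0 to [n]; the sums agree
    because the bridge vanishes at both ends. *)
Lemma integral_step_pos_indic n w :
  (\int[lebesgue_measure]_t (step_pos_indic n (w, t))%:E =
    ((positive_count (grid_steps X n w))%:R / n.+1%:R)%:E)%E.
Proof.
pose f t : R := (0 < levy_bridge X t w)%R%:R.
have f0 t : 0 <= f t by exact: ler0n.
rewrite -[LHS]/(\int[lebesgue_measure]_t (step_fun f n t)%:E)%E.
rewrite integral_step_fun//; congr (_ / _)%:E; rewrite /f {f f0}.
rewrite /positive_count natr_sum big_ord_recr big_ord_recl/=.
have b0 k : (k <= n.+1)%N ->
    bridge_sum (grid_steps X n w) k = levy_bridge X (k%:R / n.+1%:R) w.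
  exact: bridge_sum_grid_increment levyX _ _ _.
rewrite divff ?pnatr_eq0// levy_bridge1 b0// mul0r (levy_bridge0 levyX) ltxx addr0 add0r.
by apply: eq_bigr => k _; rewrite /bump leq0n add1n b0// ltnS ltnW.
Qed.

(** The L1 distance in time at a fixed sample point, which bounds the error made by the proportion
    of positive grid values. *)
Definition gap n w : \bar R :=
  (\int[lebesgue_measure]_t `|(step_pos_indic n (w, t))%:E - (pos_indic (w, t))%:E|)%E.

Lemma measurable_gap_integrand n :
  measurable_fun setT (fun z => `|(step_pos_indic n z)%:E - (pos_indic z)%:E|)%E.
Proof.
apply: measurableT_comp => //; apply: emeasurable_funB; apply/measurable_EFinP.
  exact: measurable_step_pos_indic.
exact: measurable_pos_indic.
Qed.

Lemma measurable_gap n : measurable_fun setT (gap n).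
Proof.
by have /measurable_fun_fubini_tonelli_F := measurable_gap_integrand n; exact.
Qed.

Lemma count_sub_le_gap n w :
  (`|(positive_count (grid_steps X n w))%:R / n.+1%:R - bridge_positive_time X w|%:E
    <= gap n w)%E.
Proof.
rewrite -abse_EFin EFinB -integral_step_pos_indic bridge_positive_timeE.
have i1 := integrable_pos_section w (measurable_step_pos_indic n)
  (step_pos_indic_ge0 n) (step_pos_indic_le n).
have i2 := integrable_pos_section w measurable_pos_indic pos_indic_ge0 pos_indic_le.
rewrite -integralB//; apply: le_abse_integral => //.
have /integrableP[m1 _] := i1; have /integrableP[m2 _] := i2.
exact: emeasurable_funB.
Qed.

(** Dominated convergence on the product space, with the indicator of [[0, 1]] in time as bound;
    Tonelli then writes the L1 norm as an iterated integral. *)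
Lemma cvg_integral_gap : (\int[P]_w gap n w)%E @[n --> \oo] --> 0%E.
Proof.
pose g : T * measurableTypeR R -> \bar R := fun z => (\1_(setT `*` `[0, 1]%classic) z)%:E.
have mf n : measurable_fun setT (EFin \o step_pos_indic n).
  by apply/measurable_EFinP; exact: measurable_step_pos_indic.
have mh : measurable_fun setT (EFin \o pos_indic).
  by apply/measurable_EFinP; exact: measurable_pos_indic.
have ae_cvg : \forall z \ae (P \x lebesgue_measure)%E, setT z ->
    (EFin \o step_pos_indic n) z @[n --> \oo] --> (EFin \o pos_indic) z.
  have [Z [mZ Z0 subZ]] := cut_bridge_neq0_ae; exists Z; split=> //.
  apply: subset_trans subZ => z /=; apply: contra_not => z0 _.
  by apply: cvg_EFin; [exact: nearW|exact: cvg_step_pos_indic].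
have mD : measurable (setT `*` `[0, 1]%classic : set (T * measurableTypeR R)).
  by apply: measurableX => //; exact: measurable_itv.
have ig : (P \x lebesgue_measure)%E.-integrable setT g.
  apply/integrableP; split; first by apply/measurable_EFinP; exact: measurable_indic.
  rewrite (eq_integral g); last by move=> z _; rewrite gee0_abs// lee_fin.
  rewrite integral_indic// setIT /= product_measure1E//.
  rewrite [X in (X * _)%E]probability_setT mul1e.
  by rewrite [X in (X < _)%E]lebesgue_measure_itv/= lte_fin ltr01 -EFinB ltry.
have bound : \forall z \ae (P \x lebesgue_measure)%E, forall n, setT z ->
    (`|(EFin \o step_pos_indic n) z| <= g z)%E.
  exists set0; split=> // z /=; apply => n _.
  rewrite /g /= ger0_norm ?step_pos_indic_ge0// lee_fin.
  rewrite (le_trans (step_pos_indic_le n z))//.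
  by rewrite !indicE ler_nat; case: z => w t; rewrite in_setX in_setT.
have [_ L1 _] := dominated_convergence measurableT mf mh ae_cvg ig bound.
apply: cvg_trans L1; apply: near_eq_cvg; apply: nearW => n.
by rewrite /= (fubini_tonelli1 _ (measurable_gap_integrand n)).
Qed.

(** * From L1 convergence to the distribution function *)

Lemma gap_markov n (e : R) : 0 < e ->
  (P [set w | e%:E <= gap n w] <= (e^-1)%:E * \int[P]_w gap n w)%E.
Proof.
move=> e0; have gap0 w : (0 <= gap n w)%E by apply: integral_ge0.
have /= := @le_integral_comp_abse _ _ _ P setT measurableT (gap n) e idfun
  (@measurable_id _ _ _) (fun _ h => h) (fun _ _ _ _ h => h) (measurable_gap n) e0.
rewrite setTI lee_pdivlMl//.
by under eq_integral do rewrite gee0_abs//; under eq_set do rewrite gee0_abs//.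
Qed.

Lemma measurable_gap_ge n (e : R) : measurable [set w | (e%:E <= gap n w)%E].
Proof.
rewrite -[X in measurable X]setTI; apply: emeasurable_fun_c_infty => //.
exact: measurable_gap.
Qed.

Lemma measurable_bridge_positive_time_le (x : R) :
  measurable [set w | bridge_positive_time X w <= x].
Proof.
rewrite (_ : [set w | _] = bridge_positive_time X @^-1` `]-oo, x]%classic).
  by rewrite -[X in measurable X]setTI; exact: measurable_bridge_positive_time.
by apply/seteqP; split=> w; rewrite /= in_itv.
Qed.

Lemma count_near_bridge_positive_time n (e : R) w : (gap n w < e%:E)%E ->
  `|(positive_count (grid_steps X n w))%:R / n.+1%:R - bridge_positive_time X w| < e.
Proof. by rewrite -lte_fin; apply: le_lt_trans; exact: count_sub_le_gap. Qed.

(** When the gap is below [e], an occupation time of at most [x] forces fewer than [m] positive grid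
    values, an event of known probability. *)
Lemma bridge_positive_time_law_le n (x e : R) : 0 <= x -> 0 < e ->
  (P [set w | (bridge_positive_time X w <= x)%R] <=
    (x + e + n.+1%:R^-1)%:E + P [set w | e%:E <= gap n w])%E.
Proof.
(* The least integer strictly above [n.+1%:R * (x + e)]; rounding up costs the term [n.+1%:R^-1]. *)
move=> x0 e0; pose m := (Num.truncn (n.+1%:R * (x + e))).+1.
have xe : 0 <= x + e by rewrite addr_ge0// ltW.
have mC := measurable_count_lt levyX n m; have mG := measurable_gap_ge n e.
apply: (@le_trans _ _ (P ([set w | (positive_count (grid_steps X n w) < m)%N] `|`
                          [set w | (e%:E <= gap n w)%E]))).
  apply: le_measure; rewrite ?inE//; first exact: measurable_bridge_positive_time_le.
    exact: measurableU.
  move=> w /= Ax; have [|] := leP e%:E (gap n w); first by right.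
  move=> /count_near_bridge_positive_time; rewrite ltr_norml => /andP[_ Ce]; left.
  rewrite /m -(ltr_nat R) (lt_trans _ (truncnS_gt _))// mulrC -ltr_pdivrMr ?ltr0n//.
  by move: Ce; move: (_%:R / _) => q Ce; lra.
apply: le_trans (measureU2 _ mC mG) _; apply: leeD => //.
rewrite [leLHS](positive_count_law levyX X1na) lee_fin ler_pdivrMr ?ltr0n//.
rewrite mulrDl mulVf ?pnatr_eq0// (le_trans (_ : _ <= m%:R))//.
  by rewrite ler_nat geq_minl.
by rewrite /m -natr1 lerD2r mulrC truncn_le mulr_ge0.
Qed.

(** The reverse inclusion: when the gap is below [e], a proportion of positive grid values of at
    most [x - e] keeps the occupation time below [x]. *)
Lemma bridge_positive_time_law_ge n (x e : R) : e <= x <= 1 -> 0 < e ->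
  ((x - e)%:E <=
    P [set w | (bridge_positive_time X w <= x)%R] + P [set w | e%:E <= gap n w])%E.
Proof.
move=> /andP[ex x1] e0; pose m := (Num.truncn (n.+1%:R * (x - e))).+1.
have xe : 0 <= x - e by rewrite subr_ge0.
have mC := measurable_count_lt levyX n m; have mG := measurable_gap_ge n e.
have mA := measurable_bridge_positive_time_le x.
(* Since [x - e < 1], the minimum in the law of the count is [m] itself. *)
have mn : (m <= n.+1)%N.
  rewrite /m -(ltr_nat R) (@le_lt_trans _ _ (n.+1%:R * (x - e))) ?truncn_le ?mulr_ge0//.
  by rewrite gtr_pMr ?ltr0n//; lra.
apply: (@le_trans _ _ (P [set w | (positive_count (grid_steps X n w) < m)%N])).
  rewrite [leRHS](positive_count_law levyX X1na) (minn_idPl mn) lee_fin.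
  by rewrite ler_pdivlMr ?ltr0n// mulrC ltW// truncnS_gt.
apply: le_trans (measureU2 _ mA mG); apply: le_measure; rewrite ?inE//.
  exact: measurableU.
move=> w /=; rewrite /m ltnS => Cm; have [|] := leP e%:E (gap n w); first by right.
move=> /count_near_bridge_positive_time; rewrite ltr_norml => /andP[Ce _]; left.
suff : (positive_count (grid_steps X n w))%:R / n.+1%:R <= x - e.
  by move: Ce; move: (_%:R / _) => q Ce; lra.
rewrite ler_pdivrMr ?ltr0n// mulrC (le_trans (_ : _ <= (Num.truncn (n.+1%:R * (x - e)))%:R))//.
  by rewrite ler_nat.
by rewrite truncn_le mulr_ge0.
Qed.

Lemma gap_small (e : R) : 0 < e ->
  exists n, n.+1%:R^-1 <= e /\ (P [set w | e%:E <= gap n w] <= e%:E)%E.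
Proof.
move=> e0.
(* The threshold [e * e] becomes [e] after division by the level [e] in the Markov inequality. *)
have near_gap : \forall n \near \oo, (\int[P]_w gap n w < (e * e)%:E)%E.
  have ee : (0 : R) < (fun=> e * e) (0 : R) by rewrite mulr_gt0.
  by have := cvg_integral_gap; move=> /(_ _ (@nbhs_open_ereal_lt _ 0 (fun=> e * e) ee)).
have near_e := near_infty_natSinv_lt (PosNum e0).
have [n [/= en ge]] := filter_ex (filterI near_e near_gap).
exists n; split; first exact: ltW.
apply: le_trans (gap_markov n e0) _.
by rewrite lee_pdivrMl// ltW.
Qed.

Lemma bridge_positive_time_cdf (x : R) :
  P [set w | bridge_positive_time X w <= x] = (Num.max 0 (Num.min x 1))%:E.
Proof.
have upper y : 0 <= y -> (P [set w | (bridge_positive_time X w <= y)%R] <= y%:E)%E.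
  move=> y0; apply/lee_addgt0Pr => e e0.
  (* One third each for the shift of [y], the mesh [n.+1%:R^-1] and the probability of a large
     gap. *)
  have e3 : 0 < e / 3 by rewrite divr_gt0.
  have [n [ne Pe]] := gap_small e3.
  apply: le_trans (bridge_positive_time_law_le n y0 e3) _.
  apply: le_trans (leeD (lexx _) Pe) _.
  by rewrite -!EFinD lee_fin; move: ne; move: (n.+1%:R^-1) => q; lra.
have lower y : 0 <= y <= 1 -> (y%:E <= P [set w | (bridge_positive_time X w <= y)%R])%E.
  move=> /andP[y0 y1]; apply/lee_addgt0Pr => e e0.
  (* For [y] at most [e / 2] the bound is trivial; otherwise the level [e / 2] is admissible in the
     lower estimate. *)
  have [ye|ey] := leP y (e / 2).
    by rewrite (le_trans (_ : _ <= e%:E)%E)// ?leeDr// lee_fin; lra.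
  have e2 : 0 < e / 2 by rewrite divr_gt0.
  have [n [_ Pe]] := gap_small e2.
  have eyx : e / 2 <= y <= 1 by rewrite (ltW ey).
  have := bridge_positive_time_law_ge n eyx e2.
  have {}Pe := leeD (lexx (P [set w | (bridge_positive_time X w <= y)%R])) Pe.
  move=> /le_trans /(_ Pe).
  rewrite EFinB leeBlDr// -addeA => /le_trans; apply.
  by apply: leeD => //; rewrite -EFinD lee_fin; lra.
have mono y z : y <= z -> (P [set w | (bridge_positive_time X w <= y)%R] <=
    P [set w | (bridge_positive_time X w <= z)%R])%E.
  move=> yz; apply: le_measure; rewrite ?inE; [exact: measurable_bridge_positive_time_le..|].
  by move=> w /= /le_trans; exact.
(* Outside []0, 1]], monotonicity reduces the claim to the bounds at 0 and at 1. *)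
have [x0|x0] := leP x 0.
  rewrite (min_idPl _) ?(le_trans x0)// (max_idPl x0).
  by apply/eqP; rewrite eq_le measure_ge0 andbT (le_trans (mono _ _ x0))// upper.
have [x1|x1] := leP x 1.
  by rewrite (max_idPr (ltW x0)); apply/eqP; rewrite eq_le upper ?lower ?(ltW x0).
rewrite (max_idPr ler01); apply/eqP; rewrite eq_le probability_le1//=.
  by rewrite (le_trans _ (mono _ _ (ltW x1)))// lower// ler01 lexx.
exact: measurable_bridge_positive_time_le.
Qed.

End occupation_time.

(** * Identification with the uniform law *)

Lemma uniform_prob01_cdf (R : realType) (x : R) :
  (uniform_prob (@ltr01 R) `]-oo, x]%classic = (Num.max 0 (Num.min x 1))%:E)%E.
Proof.
rewrite /uniform_prob integral_uniform_pdf.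
rewrite (_ : _ `&` _ = `[0, Num.min x 1]%classic); last first.
  apply/seteqP; split=> y; rewrite /= !in_itv/= le_min; first by move=> [-> /andP[-> ->]].
  by move=> /and3P[-> -> ->].
rewrite (eq_integral (cst 1%E)); last first.
  move=> y; rewrite inE/= in_itv/= le_min => /and3P[y0 _ y1].
  by rewrite /uniform_pdf y0 y1/= subr0 invr1.
rewrite integral_cst// mul1e [LHS]lebesgue_measure_itv/= lte_fin -EFinB subr0.
by case: ltP.
Qed.

Theorem mainTheorem14 (d : measure_display) (T : measurableType d)
  (R : realType) (P : probability T R) (X : R -> T -> R) :
  levy_process P X ->
  no_atoms P (X 1) ->
  measurable_fun setT (bridge_positive_time X) /\
  (forall B : set R, measurable B ->
     P (bridge_positive_time X @^-1` B) = uniform_prob (@ltr01 R) B).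
Proof.
move=> levyX X1na.
have mA := measurable_bridge_positive_time levyX.
split=> // B mB.
pose A : {mfun T >-> measurableTypeR R} := HB.pack (bridge_positive_time X)
  (isMeasurableFun.Build _ _ _ (measurableTypeR R) _ mA).
(* A probability on the line is determined by its distribution function. *)
suff cdfE x : distribution P A `]-oo, x]%classic = uniform_prob (@ltr01 R) `]-oo, x]%classic.
  exact: (measure_unique_closed_rays cdfE mB).
rewrite [RHS]uniform_prob01_cdf -(bridge_positive_time_cdf levyX X1na x).
rewrite /distribution /pushforward; congr (P _).
Qed.
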